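(* Assume that $$\Delta^{(\nu+1)}=(d^{(\nu)}J+c^{(\nu)})\,\Delta^{(\nu)}$$ for some positive real numbers $c^{(\nu)},d^{(\nu)}$, and that $$\frac{\alpha_{k+1}^2}{\alpha_k^2}=\frac{d^{(\nu)}k(N-k)}{2(d^{(\nu)}k+c^{(\nu)})}\,\frac{\delta_{k+1}^{(\nu)}}{\delta_k^{(\nu)}},\qquad k=1,\dots,N-1.$$ Then $$\Psi^{(\alpha,\nu)}(x)=\bigl(W^{(\alpha,\nu)}(x)\bigr)^{-1}\frac{dW^{(\alpha,\nu+1)}}{dx}(x)$$ is a matrix valued polynomial of degree one.
   Context: $N\ge1$ is an integer; scalars in matrix expressions denote multiples of the identity, and $^\ast$ is the conjugate transpose. $H_n$ are the Hermite polynomials defined by $\sum_{n\ge0}\frac{t^n}{n!}H_n(x)=e^{2xt-t^2}$. $L(x)$ is the lower triangular $N\times N$ matrix with $L(x)_{m,n}=\frac{H_{m-n}(x)}{(m-n)!}$ for $m\ge n$ and $0$ for $m<n$, $m,n\in\{1,\dots,N\}$. $\alpha_1,\dots,\alpha_N$ are non-zero real numbers with $\alpha_1=1$, $S^\alpha=\mathrm{diag}(\alpha_1,\dots,\alpha_N)$, $L^\alpha(x)=S^\alpha L(x)(S^\alpha)^{-1}$, $J=\mathrm{diag}(1,2,\dots,N)$. $\Delta^{(\nu)}=\mathrm{diag}(\delta_1^{(\nu)},\dots,\delta_N^{(\nu)})$ and $\Delta^{(\nu+1)}=\mathrm{diag}(\delta_1^{(\nu+1)},\dots,\delta_N^{(\nu+1)})$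 are diagonal matrices with positive diagonal entries, and for $\kappa\in\{\nu,\nu+1\}$ $$W^{(\alpha,\kappa)}(x)=e^{-x^2}L^\alpha(x)\,\Delta^{(\kappa)}\,L^\alpha(x)^\ast,\qquad x\in\mathbb{R}.$$ *)

(* Defs.v *)
From mathcomp Require Import all_boot all_order all_algebra.
From mathcomp Require Import all_classical all_reals all_analysis.

Set Implicit Arguments.
Unset Strict Implicit.
Unset Printing Implicit Defensive.

Import Order.TTheory GRing.Theory Num.Theory.
Import numFieldNormedType.Exports.

Local Open Scope classical_set_scope.
Local Open Scope ring_scope.

(* This determines H uniquely, by uniqueness of power series coefficients
   in t for each x. *)
Definition hermite_polynomials (R : realType) (H : nat -> {poly R}) : Prop :=
  forall x t : R,
    series (fun n => t ^+ n / n`!%:R * (H n).[x]) @ \oo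
      --> expR (2 * x * t - t ^+ 2).

(* Below, matrices have size N = n.+1 and the index i : 'I_N stands for the
   1-based index i.+1. *)

Definition Lmx (R : realType) (n : nat) (H : nat -> {poly R}) (x : R) :
    'M[R]_n.+1 :=
  \matrix_(i, j)
    (if (j <= i)%N then (H (i - j)%N).[x] / (i - j)`!%:R else 0).

Definition Lalpha (R : realType) (n : nat) (H : nat -> {poly R})
    (alpha : 'rV[R]_n.+1) (x : R) : 'M[R]_n.+1 :=
  diag_mx alpha *m Lmx n H x *m invmx (diag_mx alpha).

Definition Jmx (R : realType) (n : nat) : 'M[R]_n.+1 :=
  diag_mx (\row_i i.+1%:R).

(* All matrices here have real entries, so the conjugate transpose is ^T. *)
Definition Wmx (R : realType) (n : nat) (H : nat -> {poly R})
    (alpha delta : 'rV[R]_n.+1) (x : R) : 'M[R]_n.+1 :=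
  expR (- x ^+ 2) *:
    (Lalpha H alpha x *m diag_mx delta *m (Lalpha H alpha x)^T).

(* delta and delta' are the diagonals of Delta^(nu) and Delta^(nu+1). *)
Definition Psi (R : realType) (n : nat) (H : nat -> {poly R})
    (alpha delta delta' : 'rV[R]_n.+1) (x : R) : 'M[R]_n.+1 :=
  invmx (Wmx H alpha delta x) *m derive1 (Wmx H alpha delta') x.

(* Evaluation is at the scalar matrix x%:M, which commutes with the matrix
   coefficients of p. *)
Definition mx_polynomial_of_degree (R : realType) (n d : nat)
    (F : R -> 'M[R]_n.+1) : Prop :=
  exists p : {poly 'M[R]_n.+1},
    size p = d.+1 /\ (forall x : R, F x = p.[x%:M]).

(* Main.v *)
Require Import Defs.
From mathcomp Require Import all_boot all_order all_algebra.
From mathcomp Require Import all_classical all_reals all_analysis.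
From mathcomp Require Import ring lra.

(** Write N = n.+1, A for the lower shift matrix, M(x) = 2 (x - A), and K for
the matrix with entries k (N - k) just above the diagonal.  Let L = L(x),
S = S^alpha and E = d J + c, so that Delta' = E Delta.

The generating function of the Hermite polynomials is the power series
e^(2xt - t^2) in t; differentiating it in t gives the recurrence
(k+1) h_(k+1) = 2 x h_k - 2 h_(k-1) for h_k = H_k / k! ([hermite_recurrence]),
hence also h_k' = 2 h_(k-1), which says L' = 2 L A ([is_derive_Lmx]).
The product rule then gives
  dW^(nu+1)/dx = e^(-x^2) L^alpha Y (L^alpha)^T,
  Y = - 2 x E Delta + E Delta B^T + B E Delta,   B = 2 S A S^-1
([is_derive_Wmx]).

The hypothesis on alpha says exactly that the superdiagonal part of Y is
S (d K) S^-1 Delta ([shift_balance]), so that Y = S (d K - M E) S^-1 Delta.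
As Y is symmetric, Psi^T is S L (d K - M E) L^-1 S^-1, and it remains to move
d K - M E through L.  The recurrence identifies the entries of M L, and a
comparison of entries yields the commutator
  [K, L] = (N + 1) M L - J M L - M L J
([Lmx_commutator]).  Since M commutes with L, the terms M L J and L M J, which
become quadratic in x after conjugation by L, cancel:
  L (d K - M E) = (d K + (d J - d (N + 1) - c) M) L
([Lmx_conjugation]).  Consequently
  Psi(x)^T = S (d K + (d J - d (N + 1) - c) M(x)) S^-1
([Psi_closed_form]).  This is affine in x, and the coefficient of x is
conjugate to 2 (d J - d (N + 1) - c), a diagonal matrix with negative diagonal
entries, so the degree is exactly one. *)

Set Implicit Arguments.
Unset Strict Implicit.

Import Order.TTheory GRing.Theory Num.Theory.
Import numFieldNormedType.Exports.

Local Open Scope ring_scope.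
Local Open Scope classical_set_scope.

(** * Power series converging on the whole line *)

(** Since n + 1 <= 2^(n+1), the terms of the differentiated series at t are
dominated by those of the original one at 2 (|t| + 1), which converges
absolutely because the series converges at a larger point. *)
Lemma cvg_pseries_diffs (R : realType) (c : nat -> R) :
  (forall t, cvgn (pseries c t)) ->
  forall t, cvgn (pseries (pseries_diffs c) t).
Proof.
move=> Cc t; set r := 2 * (`|t| + 1).
have r0 : 0 <= r by rewrite mulr_ge0 ?addr_ge0.
have rlt : `|r| < `|r + 1| by rewrite !ger0_norm ?addr_ge0// ltrDl.
have := is_cvg_pseries_inside_norm (Cc (r + 1)) rlt.
move=> Cl.
apply: normed_cvg; apply: (@series_le_cvg _ _ (fun n => `|c n.+1| * r ^+ n.+1)).
- by move=> n; rewrite normr_ge0.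
- by move=> n; rewrite mulr_ge0 ?exprn_ge0.
- move=> n /=; rewrite /pseries_diffs !normrM normr_nat normrX -mulrA mulrCA.
  rewrite ler_wpM2l// /r exprMn ler_pM//.
  + by rewrite -natrX ler_nat ltnW// ltn_expl.
  + apply: (@le_trans _ _ ((`|t| + 1) ^+ n)).
      by rewrite lerXn2r ?nnegrE ?addr_ge0// lerDl.
    by rewrite ler_weXn2l// lerDr.
- rewrite (_ : series _ =
      (fun n => pseries (fun i => `|c i|) r n.+1 - `|c 0%N|)).
    apply: is_cvgB; last exact: is_cvg_cst.
    by move: Cl => /cvg_ex[l]; rewrite -cvg_shiftS => /cvgP.
  apply/funext => n.
  by rewrite /pseries /series/= [in RHS]big_nat_recl//= expr0 mulr1 addrC addKr.
Qed.

Lemma is_derive_pseries (R : realType) (c : nat -> R) (t : R) :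
  (forall t, cvgn (pseries c t)) ->
  is_derive t 1 (fun t => limn (pseries c t))
    (limn (pseries (pseries_diffs c) t)).
Proof.
move=> Cc; have Cd := cvg_pseries_diffs Cc.
apply: (@pseries_snd_diffs _ _ (`|t| + 1)) => //; first exact: cvg_pseries_diffs.
by rewrite [ltRHS]ger0_norm ?addr_ge0// ltrDl.
Qed.

Lemma cvg_pseries0 (R : realType) (c : nat -> R) : pseries c 0 @ \oo --> c 0%N.
Proof.
rewrite -cvg_shiftS; apply: cvg_near_cst; apply: nearW => n.
rewrite /pseries /series/= big_nat_recl// expr0 mulr1.
by rewrite big1 ?addr0// => i _; rewrite expr0n mulr0.
Qed.

(** Uniqueness of coefficients: the constant term is the value at 0, and the
differentiated series is again zero everywhere, so induction applies to it. *)
Lemma pseries_eq0 (R : realType) (c : nat -> R) :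
  (forall t, pseries c t @ \oo --> (0 : R)) -> forall n, c n = 0.
Proof.
move=> c0 n; elim: n c c0 => [|n IH] c c0.
  by rewrite -(cvg_lim _ (@cvg_pseries0 _ c))// (cvg_lim _ (c0 0)).
have Cc t : cvgn (pseries c t) by apply/cvg_ex; exists 0.
have /IH/eqP : forall t, pseries (pseries_diffs c) t @ \oo --> (0 : R).
  move=> t; have Cd := cvg_pseries_diffs Cc.
  have dc := is_derive_pseries t Cc.
  suff <- : limn (pseries (pseries_diffs c) t) = 0 by exact: Cd.
  rewrite -(@derive_val _ _ _ _ _ _ _ dc).
  rewrite (_ : (fun _ => _) = cst 0) ?derive_cst//.
  by apply/funext => u; apply/cvg_lim => //.
by rewrite mulf_eq0 pnatr_eq0/= => /eqP.
Qed.

Lemma cvg_pseries_shift (R : realType) (c : nat -> R) (t l : R) :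
  pseries c t @ \oo --> l ->
  pseries (fun n => if n is m.+1 then c m else 0) t @ \oo --> t * l.
Proof.
move=> cl; rewrite -cvg_shiftS /=.
rewrite [X in X @ _](_ : _ = fun n => t * pseries c t n).
  by apply: cvgMr.
apply/funext => n; rewrite /pseries /series/= big_nat_recl//= mul0r add0r mulr_sumr.
by apply: eq_bigr => i _; rewrite exprS mulrCA.
Qed.

(** * Hermite polynomials *)

Lemma hermite_pseries (R : realType) (H : nat -> {poly R}) :
  hermite_polynomials H -> forall x t : R,
  pseries (fun n => (H n).[x] / n`!%:R) t @ \oo --> expR (2 * x * t - t ^+ 2).
Proof.
move=> hH x t; have Ht := hH x t; rewrite /pseries.
rewrite (_ : (fun _ => _) = fun n => t ^+ n / n`!%:R * (H n).[x])//.
by apply/funext => n; rewrite mulrC mulrCA mulrC mulrAC.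
Qed.

Lemma hermite0 (R : realType) (H : nat -> {poly R}) :
  hermite_polynomials H -> forall x, (H 0%N).[x] = 1.
Proof.
move=> hH x; have /cvg_lim := @hermite_pseries _ _ hH x 0.
rewrite (cvg_lim _ (@cvg_pseries0 _ _))// divr1 => ->//.
by rewrite mulr0 expr0n subr0 expR0.
Qed.

(** In t, the generating function G satisfies dG/dt = (2 x - 2 t) G; compare the
coefficients of the power series of both sides. *)
Lemma hermite_recurrence (R : realType) (H : nat -> {poly R}) (x : R) :
  hermite_polynomials H ->
  let c n := (H n).[x] / n`!%:R in
  c 1%N = 2 * x * c 0%N /\
  forall n, n.+2%:R * c n.+2 = 2 * x * c n.+1 - 2 * c n.
Proof.
move=> hH c; pose s n := if n is m.+1 then c m else 0.
have Ec t : pseries c t @ \oo --> expR (2 * x * t - t ^+ 2).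
  exact: hermite_pseries.
have Cc t : cvgn (pseries c t) by exact: cvgP (Ec t).
have Ed t : pseries (pseries_diffs c) t @ \oo -->
    (2 * x - 2 * t) * expR (2 * x * t - t ^+ 2).
  have dc := is_derive_pseries t Cc.
  rewrite (_ : (_ - _) * _ = limn (pseries (pseries_diffs c) t)).
    exact: cvg_pseries_diffs.
  rewrite -(@derive_val _ _ _ _ _ _ _ dc).
  rewrite (_ : (fun _ => _) = fun t => expR (2 * x * t - t ^+ 2)); last first.
    by apply/funext => u; apply/cvg_lim.
  apply/esym; apply: derive_val.
  apply: is_derive_eq.
  rewrite /GRing.scale/=; ring.
have e0 n : pseries_diffs c n - (2 * x * c n - 2 * s n) = 0.
  apply: (@pseries_eq0 _ (fun n => pseries_diffs c n - (2 * x * c n - 2 * s n))).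
  move=> t.
  rewrite (_ : pseries _ t = fun n => pseries (pseries_diffs c) t n
     - (2 * x * pseries c t n - 2 * pseries s t n)).
    rewrite (_ : 0 = (2 * x - 2 * t) * expR (2 * x * t - t ^+ 2) -
      (2 * x * expR (2 * x * t - t ^+ 2) - 2 * (t * expR (2 * x * t - t ^+ 2))));
      last by ring.
    apply: cvgB => //; apply: cvgB; apply: cvgMr => //.
    exact: cvg_pseries_shift.
  apply/funext => m; rewrite /pseries /series/= !mulr_sumr -!sumrB.
  by apply: eq_bigr => i _; ring.
split; first by have := e0 0%N; rewrite /pseries_diffs /s => ?; lra.
by move=> n; have := e0 n.+1; rewrite /pseries_diffs /s => ?; lra.
Qed.

(** The coefficient of t^k in the generating function; in this normalization
differentiation in x is twice the index shift. *)
Definition hermite_div (R : realType) (H : nat -> {poly R}) (k : nat)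
    (x : R) : R :=
  (H k).[x] / k`!%:R.

(** Differentiating the recurrence for index k + 2 and inserting the induction
hypothesis produces twice the recurrence for index k + 1. *)
Lemma is_derive_hermite_div (R : realType) (H : nat -> {poly R}) :
  hermite_polynomials H -> forall (x : R) k,
  is_derive x 1 (hermite_div H k.+1) (2 * hermite_div H k x).
Proof.
move=> hH x k.
have c0 y : hermite_div H 0 y = 1 by rewrite /hermite_div hermite0// divr1.
have [c1 cS] : hermite_div H 1 = (fun y => 2 * y) /\
    forall n, hermite_div H n.+2 = fun y =>
      n.+2%:R^-1 * (2 * y * hermite_div H n.+1 y - 2 * hermite_div H n y).
  split=> [|n]; apply/funext => y; have [E0 ES] := hermite_recurrence y hH.
    by rewrite [LHS]E0 -/(hermite_div H 0 y) c0 mulr1.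
  by rewrite -[_ - _]ES mulKf// pnatr_eq0.
have D1 : is_derive x 1 (hermite_div H 1) (2 * hermite_div H 0 x).
  rewrite c1 c0; apply: is_derive_eq; rewrite /GRing.scale/=; ring.
suff [] : is_derive x 1 (hermite_div H k.+1) (2 * hermite_div H k x) /\
  is_derive x 1 (hermite_div H k.+2) (2 * hermite_div H k.+1 x) by [].
elim: k => [|k [IH1 IH2]].
  split=> //; rewrite (cS 0%N).
  rewrite (_ : hermite_div H 0 = cst 1); last exact/funext/c0.
  apply: is_derive_eq; rewrite c1 /GRing.scale/= c0; field => //.
split; first exact: IH2.
rewrite (cS k.+1).
apply: is_derive_eq; rewrite /GRing.scale/= (cS k); field.
by rewrite -!natrD !pnatr_eq0.
Qed.

(** * Derivatives of matrix-valued functions *)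

Lemma is_derive_mx (R : realType) (m p : nat) (F : R -> 'M[R]_(m, p)) (x : R)
    (F' : 'M[R]_(m, p)) :
  (forall i j, is_derive x 1 (fun y => F y i j) (F' i j)) -> is_derive x 1 F F'.
Proof.
move=> dF; have DF : derivable F x 1 by apply/derivable_mxP => i j; case: (dF i j).
by split=> //; rewrite derive_mx//; apply/matrixP => i j; rewrite mxE derive_val.
Qed.

Lemma is_derive_mx_entry (R : realType) (m p : nat) (F : R -> 'M[R]_(m, p)) (x : R)
    (F' : 'M[R]_(m, p)) i j :
  is_derive x 1 F F' -> is_derive x 1 (fun y => F y i j) (F' i j).
Proof.
case=> DF <-; split; first by move/derivable_mxP : DF; apply.
by rewrite derive_mx// mxE.
Qed.

Lemma is_derive_mulmx (R : realType) (m p q : nat) (F : R -> 'M[R]_(m, p))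
    (G : R -> 'M[R]_(p, q)) (x : R)
    (F' : 'M[R]_(m, p)) (G' : 'M[R]_(p, q)) :
  is_derive x 1 F F' -> is_derive x 1 G G' ->
  is_derive x 1 (fun y => F y *m G y) (F' *m G x + F x *m G').
Proof.
move=> dF dG; apply: is_derive_mx => i j.
rewrite (_ : (fun _ => _) = \sum_k (fun y => F y i k * G y k j)); last first.
  by apply/funext => y; rewrite mxE fct_sumE.
rewrite !mxE -big_split/=; apply: is_derive_sum => k.
have dFk := is_derive_mx_entry i k dF; have dGk := is_derive_mx_entry k j dG.
by apply: is_derive_eq; rewrite addrC; congr (_ + _); exact: mulrC.
Qed.

Lemma is_derive_trmx (R : realType) (m p : nat) (F : R -> 'M[R]_(m, p)) (x : R)
    (F' : 'M[R]_(m, p)) :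
  is_derive x 1 F F' -> is_derive x 1 (fun y => (F y)^T) F'^T.
Proof.
move=> dF; apply: is_derive_mx => i j; rewrite mxE.
rewrite (_ : (fun _ => _) = fun y => F y j i); first exact: is_derive_mx_entry.
by apply/funext => y; rewrite mxE.
Qed.

Lemma is_derive_scalemx (R : realType) (m p : nat) (f : R -> R)
    (F : R -> 'M[R]_(m, p)) (x f' : R) (F' : 'M[R]_(m, p)) :
  is_derive x 1 f f' -> is_derive x 1 F F' ->
  is_derive x 1 (fun y => f y *: F y) (f' *: F x + f x *: F').
Proof.
move=> df dF; apply: is_derive_mx => i j.
rewrite (_ : (fun _ => _) = fun y => f y * F y i j); last first.
  by apply/funext => y; rewrite mxE.
have dFk := is_derive_mx_entry i j dF.
by rewrite !mxE; apply: is_derive_eq; rewrite addrC [_ *: f']mulrC.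
Qed.

(** * The matrix L of Hermite polynomials *)

Definition shift_mx (R : realType) (n : nat) : 'M[R]_n.+1 :=
  \matrix_(i, j) (i == j.+1 :> nat)%:R.

(** The weights k (N - k) are those for which this matrix and the shift A satisfy
[K, A] = N + 1 - 2 J, as the raising and lowering operators of sl(2). *)
Definition ladder_mx (R : realType) (n : nat) : 'M[R]_n.+1 :=
  \matrix_(i, j) ((j == i.+1 :> nat)%:R * (i.+1%:R * (n.+1%:R - i.+1%:R))).

(** L is f(A) for the generating function f(t) = e^(2xt - t^2) and the shift A;
this is the value at A of f'/f. *)
Definition hermite_shift_mx (R : realType) (n : nat) (x : R) : 'M[R]_n.+1 :=
  2 *: (x%:M - shift_mx R n).

(** The entries of L, extended to all pairs of natural numbers: multiplication
by the shift or by K then amounts to changing an index, and the boundary rows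
and columns need no separate treatment. *)
Definition Lentry (R : realType) (H : nat -> {poly R}) (x : R) (i j : nat) : R :=
  if (j <= i)%N then hermite_div H (i - j) x else 0.

Lemma LmxE (R : realType) n (H : nat -> {poly R}) (x : R) i j :
  Lmx n H x i j = Lentry H x i j.
Proof. by rewrite mxE. Qed.

Lemma LentryS (R : realType) (H : nat -> {poly R}) (x : R) (i j : nat) :
  Lentry H x i.+1 j.+1 = Lentry H x i j.
Proof. by []. Qed.

Lemma mul_shift_LmxE (R : realType) n (H : nat -> {poly R}) (x : R) i j :
  (shift_mx R n * Lmx n H x) i j = Lentry H x i j.+1.
Proof.
rewrite mxE; case: i => [[|i] ilt] /=.
  by rewrite /Lentry/= big1// => k _; rewrite !mxE mul0r.
rewrite (bigD1 (Ordinal (ltnW ilt)))//= LmxE mxE eqxx mul1r.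
rewrite big1 ?addr0 ?LentryS// => k; rewrite mxE eqSS eq_sym -val_eqE/= => /negPf->.
by rewrite mul0r.
Qed.

Lemma mul_Lmx_shiftE (R : realType) n (H : nat -> {poly R}) (x : R) i j :
  (Lmx n H x * shift_mx R n) i j = Lentry H x i j.+1.
Proof.
rewrite mxE; have [jn|nj] := ltnP j.+1 n.+1.
  rewrite (bigD1 (Ordinal jn))//= LmxE mxE eqxx mulr1.
  rewrite big1 ?addr0// => k; rewrite [X in _ -> _ * X = _]mxE -val_eqE/=.
  by move=> /negPf->; rewrite mulr0.
rewrite big1 => [|k _]; first by rewrite /Lentry leqNgt (leq_trans (ltn_ord i)).
by rewrite [X in _ * X]mxE ltn_eqF ?mulr0// (leq_trans (ltn_ord k)).
Qed.

Lemma is_derive_Lmx (R : realType) n (H : nat -> {poly R}) (x : R) :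
  hermite_polynomials H ->
  is_derive x 1 (fun y => Lmx n H y) (2 *: (Lmx n H x * shift_mx R n)).
Proof.
move=> hH; apply: is_derive_mx => i j; rewrite mxE mul_Lmx_shiftE.
rewrite (_ : (fun _ => _) = fun y => Lentry H y i j); last first.
  by apply/funext => y; rewrite LmxE.
rewrite /Lentry; case: (ltngtP i j) => ij.
- by rewrite mulr0; exact: is_derive_cst.
- rewrite subnS -[X in hermite_div H X](@prednK (i - j)%N) ?subn_gt0//.
  exact: is_derive_hermite_div.
- rewrite ij subnn mulr0 (_ : (fun _ => _) = cst 1); first exact: is_derive_cst.
  by apply/funext => y; rewrite /hermite_div hermite0// divr1.
Qed.

Lemma comm_hermite_shift_Lmx (R : realType) n (H : nat -> {poly R}) (x : R) :
  Lmx n H x * hermite_shift_mx n x = hermite_shift_mx n x * Lmx n H x.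
Proof.
rewrite /hermite_shift_mx -scalerAr -scalerAl mulrBr mulrBl; congr (_ *: (_ - _)).
  exact: scalar_mxC.
by apply/matrixP => i j; rewrite mul_shift_LmxE mul_Lmx_shiftE.
Qed.

(** The Hermite recurrence, read off along the diagonals of L. *)
Lemma mul_hermite_shift_LmxE (R : realType) n (H : nat -> {poly R}) (x : R) i j :
  hermite_polynomials H ->
  (hermite_shift_mx n x * Lmx n H x) i j = (i.+1%:R - j%:R) * Lentry H x i.+1 j.
Proof.
move=> hH; have -> : (hermite_shift_mx n x * Lmx n H x) i j =
    2 * (x * Lmx n H x i j - (shift_mx R n * Lmx n H x) i j).
  rewrite /hermite_shift_mx -scalerAl mulrBl -[x%:M * _]/(x%:M *m _).
  by rewrite mul_scalar_mx !mxE.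
rewrite mul_shift_LmxE LmxE /Lentry; have [E0 ES] := hermite_recurrence x hH.
case: (ltngtP i j) => ij.
- rewrite mulr0 subrr mulr0.
  case: leqP => //; last by rewrite mulr0.
  by move=> ji; rewrite (_ : i.+1 = j) ?subrr ?mul0r//; apply/eqP; rewrite eqn_leq ij.
- have e : (i - j = (i - j.+1).+1)%N by rewrite subnSK.
  rewrite (leqW (ltnW ij)) -natrB ?(leqW (ltnW ij))// (subSn (ltnW ij)).
  rewrite e [RHS]ES /hermite_div; ring.
- rewrite ij leqnSn subSnn subnn subr0 -natrB// subSnn mul1r.
  rewrite [RHS]E0 /hermite_div; ring.
Qed.

(** In the last row the index i + 1 falls outside the matrix, but there the
factor n.+1 - i.+1 vanishes; the first column of [mul_Lmx_ladderE] is similar. *)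
Lemma mul_ladder_LmxE (R : realType) n (H : nat -> {poly R}) (x : R) i j :
  (ladder_mx R n * Lmx n H x) i j =
    i.+1%:R * (n.+1%:R - i.+1%:R) * Lentry H x i.+1 j.
Proof.
rewrite mxE; have [jn|] := ltnP i.+1 n.+1.
  rewrite (bigD1 (Ordinal jn))//= LmxE mxE eqxx mul1r.
  rewrite big1 ?addr0// => k; rewrite mxE -val_eqE/= => /negPf->.
  by rewrite !mul0r.
move=> ni; have -> : (i.+1 = n.+1)%N by apply/eqP; rewrite eqn_leq ni ltn_ord.
rewrite subrr mulr0 mul0r big1// => k _; rewrite mxE.
by rewrite ltn_eqF ?mul0r// (leq_trans (ltn_ord k)).
Qed.

Lemma mul_Lmx_ladderE (R : realType) n (H : nat -> {poly R}) (x : R) i j :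
  (Lmx n H x * ladder_mx R n) i j = j%:R * (n.+1%:R - j%:R) * Lentry H x i.+1 j.
Proof.
rewrite mxE; case: j => [[|j] jlt] /=.
  by rewrite !mul0r big1// => k _; rewrite !mxE/= mul0r mulr0.
rewrite (bigD1 (Ordinal (ltnW jlt)))//= LmxE mxE eqxx mul1r LentryS.
rewrite big1 ?addr0 => [|k]; first by rewrite mulrC.
rewrite [X in _ -> _ * X = _]mxE/= eqSS eq_sym -val_eqE/= => /negPf->.
by rewrite !mul0r mulr0.
Qed.

(** With 1-based indices, all terms at (p, q) are multiples of h_(p-q+1), and
p (N - p) - (q - 1) (N - q + 1) = (N + 1 - p - q) (p - q + 1), where the last
factor is the one that the recurrence turns into M L. *)
Lemma Lmx_commutator (R : realType) n (H : nat -> {poly R}) (x : R) :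
  hermite_polynomials H ->
  let L := Lmx n H x in let M := hermite_shift_mx n x in let J := Jmx R n in
  ladder_mx R n * L =
    L * ladder_mx R n + n.+2%:R *: (M * L) - J * (M * L) - M * L * J.
Proof.
move=> hH L M J; apply/matrixP => i j.
rewrite [RHS]mxE [in RHS]mxE [in RHS]mxE [X in _ = _ + X + _ + _]mxE.
rewrite [X in _ = _ + X + _]mxE [X in _ = _ + X]mxE.
rewrite /J /Jmx -!mulmxE mul_diag_mx mul_mx_diag !mulmxE [X in _ = _ - X - _]mxE.
rewrite [X in _ = _ - _ - X]mxE !mul_hermite_shift_LmxE// mul_ladder_LmxE.
rewrite mul_Lmx_ladderE !mxE.
by ring.
Qed.

(** The conjugates by L of K and of M J are both quadratic in x; the choice
E = d J + c makes d M L J, which the commutator produces, cancel d L M J. *)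
Lemma Lmx_conjugation (R : realType) n (H : nat -> {poly R}) (x c d : R) :
  hermite_polynomials H ->
  let L := Lmx n H x in let M := hermite_shift_mx n x in let J := Jmx R n in
  L * (d *: ladder_mx R n - M * (d *: J + c%:M)) =
  (d *: ladder_mx R n + (d *: J - (d * n.+2%:R + c)%:M) * M) * L.
Proof.
move=> hH L M J; have := Lmx_commutator n x hH.
have := comm_hermite_shift_Lmx n H x.
rewrite /= -/L -/M -/J.
move: (ladder_mx R n) (n.+2%:R : R) @L @M @J => K N L M J LM KL.
have -> : L * (d *: K - M * (d *: J + c%:M)) =
    d *: (L * K) - d *: (M * L * J) - c *: (M * L).
  rewrite mulrBr mulrA LM mulrDr -!scalerAr -[_ * c%:M]/(_ *m c%:M) mul_mx_scalar.
  by rewrite opprD addrA.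
have -> : (d *: K + (d *: J - (d * N + c)%:M) * M) * L =
    d *: (K * L) + d *: (J * (M * L)) - (d * N + c) *: (M * L).
  rewrite mulrDl -mulrA mulrBl -!scalerAl -[_%:M * _]/(_%:M *m _) mul_scalar_mx.
  by rewrite addrA.
rewrite KL.
move: (L * K) (J * (M * L)) (M * L * J) (M * L) => X1 X2 X3 X4.
by apply/matrixP => i j; rewrite !mxE; ring.
Qed.

(** * The weight and its logarithmic derivative *)

Lemma unitmx_diag (F : fieldType) n (a : 'rV[F]_n) :
  (forall i, a 0 i != 0) -> diag_mx a \in unitmx.
Proof.
move=> a0; rewrite unitmxE det_diag unitfE.
by apply/prodf_neq0 => i _; exact: a0.
Qed.

Lemma invmx_diag (F : fieldType) n (a : 'rV[F]_n) :
  (forall i, a 0 i != 0) -> invmx (diag_mx a) = diag_mx (\row_i (a 0 i)^-1).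
Proof.
move=> a0; rewrite -[LHS]mulmx1; apply: (canLR (mulKmx (unitmx_diag a0))).
rewrite mulmx_diag -diag_const_mx; congr diag_mx.
by apply/rowP => i; rewrite !mxE mulfV.
Qed.

Lemma Lmx_unit (R : realType) n (H : nat -> {poly R}) (x : R) :
  hermite_polynomials H -> Lmx n H x \in unitmx.
Proof.
move=> hH; rewrite unitmxE det_trig.
  rewrite big1 ?unitr1// => i _; rewrite mxE leqnn subnn hermite0//.
  by rewrite divr1.
by apply/is_trig_mxP => i j ij; rewrite mxE leqNgt ij.
Qed.

Lemma is_derive_Lalpha (R : realType) n (H : nat -> {poly R})
    (alpha : 'rV[R]_n.+1) (x : R) :
  hermite_polynomials H -> (forall i : 'I_n.+1, alpha 0 i != 0) ->
  let S := diag_mx alpha in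
  is_derive x 1 (fun y => Lalpha H alpha y)
    (Lalpha H alpha x * (2 *: (S * shift_mx R n * invmx S))).
Proof.
move=> hH a0 S; have US : S \in unitmx by exact: unitmx_diag.
have dL := is_derive_Lmx n x hH.
have dS := is_derive_mulmx (is_derive_cst S x 1) dL.
apply: (is_derive_eq (is_derive_mulmx dS (is_derive_cst (invmx S) x 1))).
rewrite mul0mx add0r mulmx0 addr0 /Lalpha -/S.
rewrite -!mulmxE -scalemxAr -scalemxAr -scalemxAl; congr (_ *: _).
by rewrite -!mulmxA mulKmx.
Qed.

Lemma is_derive_Wmx (R : realType) n (H : nat -> {poly R})
    (alpha delta : 'rV[R]_n.+1) (x : R) :
  hermite_polynomials H -> (forall i : 'I_n.+1, alpha 0 i != 0) ->
  let S := diag_mx alpha in let D := diag_mx delta in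
  let A := 2 *: (S * shift_mx R n * invmx S) in let L := Lalpha H alpha x in
  is_derive x 1 (fun y => Wmx H alpha delta y)
    (expR (- x ^+ 2) *: (L * (- (2 * x) *: D + D * A^T + A * D) * L^T)).
Proof.
move=> hH a0 S D A L.
have dL : is_derive x 1 (fun y => Lalpha H alpha y) (L * A).
  exact: is_derive_Lalpha.
have dLD := is_derive_mulmx dL (is_derive_cst D x 1).
have dP := is_derive_mulmx dLD (is_derive_trmx dL).
have de : is_derive x 1 (fun y => expR (- y ^+ 2))
    (- (2 * x) * expR (- x ^+ 2)).
  by apply: is_derive_eq; rewrite /GRing.scale/=; ring.
apply: (is_derive_eq (is_derive_scalemx de dP)).
rewrite mulmx0 addr0 -/L !mulmxE /cst; clear dL dLD dP de; clearbody L A.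
rewrite -[(L * A)^T]/((L *m A)^T) trmx_mul; move: L^T A^T => LT AT.
move: (- (2 * x)) => s.
rewrite [s * _]mulrC -scalerA -scalerDr; congr (_ *: _).
rewrite !mulrDr !mulrDl -scalerAr -scalerAl !mulmxE !mulrA -!addrA.
by congr (_ + _); exact: addrC.
Qed.

(** Both sides have entries only just above the diagonal, where the equality is
the relation between consecutive alpha and delta. *)
Lemma shift_balance (R : realType) (n : nat) (alpha delta : 'rV[R]_n.+1)
    (c d : R) :
  (forall i : 'I_n.+1, alpha 0 i != 0) ->
  (forall i : 'I_n.+1, 0 < delta 0 i) -> 0 < c -> 0 < d ->
  (forall i j : 'I_n.+1, j = i.+1 :> nat ->
       alpha 0 j ^+ 2 / alpha 0 i ^+ 2 =
         d * i.+1%:R * (n.+1%:R - i.+1%:R) / (2 * (d * i.+1%:R + c))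
         * (delta 0 j / delta 0 i)) ->
  let S := diag_mx alpha in let D := diag_mx delta in
  (d *: Jmx R n + c%:M) * D * (2 *: (S * shift_mx R n * invmx S))^T =
  S * (d *: ladder_mx R n) * invmx S * D.
Proof.
move=> a0 D0 c0 d0 aE S D.
have -> : d *: Jmx R n + c%:M = diag_mx (\row_i (d * i.+1%:R + c)).
  apply/matrixP => i j; rewrite !mxE.
  by case: (i == j); rewrite ?mulr1n ?mulr0n ?mulr0 ?addr0.
rewrite /S invmx_diag// -!mulmxE mulmx_diag !(mul_diag_mx, mul_mx_diag).
apply/matrixP => i j; rewrite !mxE.
have [ji|] := eqVneq (j : nat) i.+1; last by rewrite !(mulr0, mul0r).
have /= E0 := aE i j ji.
rewrite mul1r mulr1; move: (a0 i) (a0 j) (D0 i) (D0 j) E0.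
set ai := alpha 0 i; set aj := alpha 0 j.
set di := delta 0 i; set dj := delta 0 j.
set N := n.+1%:R; set k := i.+1%:R => ai0 aj0 di0 dj0 E0.
have k0 : 0 < d * k + c by rewrite addr_gt0// mulr_gt0// ltr0Sn.
clearbody ai aj di dj N k.
have {}E0 : 2 * (d * k + c) * di * aj ^+ 2 = d * k * (N - k) * dj * ai ^+ 2.
  have -> : aj ^+ 2 = aj ^+ 2 / ai ^+ 2 * ai ^+ 2 by rewrite divfK// sqrf_eq0.
  rewrite E0; field; rewrite !gt_eqF//.
apply: (mulIf ai0); apply: (mulIf aj0).
rewrite (_ : _ * aj = (2 * (d * k + c) * di * aj ^+ 2)); last by field.
by rewrite E0; field.
Qed.

(** The noncommutative algebra behind the closed form. The middle factor Y on the
left is symmetric, so Y = (S (K - M E) S^-1 D)^T, and the intertwining relation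
for L lets the transposed conjugated factor come out on the right. Here S', D,
K, F stand for S^-1, Delta, d K and d J - d (N + 1) - c. *)
Lemma intertwining_transport (R : comNzRingType) n
    (S S' D E K F M L N : 'M[R]_n.+1) (x : R) :
  S' * S = 1 -> S * S' = 1 -> S' * E = E * S' -> D * E = E * D ->
  E^T = E -> D^T = D -> M = (2 * x)%:M - 2 *: N ->
  L * (K - M * E) = (K + F * M) * L ->
  let A : 'M[R]_n.+1 := 2 *: (S * N * S') in
  let Ls : 'M[R]_n.+1 := S * L * S' in
  E * D * A^T = S * K * S' * D ->
  Ls * (- (2 * x) *: (E * D) + E * D * A^T + A * (E * D)) * Ls^T =
  Ls * D * Ls^T * (S * (K + F * M) * S' : 'M[R]_n.+1)^T.
Proof.
move=> S'S SS' S'E DE ET DT ME LG A Ls bal.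
set Y : 'M[R]_n.+1 := _ + A * (E * D).
have EDT : @trmx R _ _ (E * D) = E * D.
  by apply: etrans (trmx_mul _ _) _; rewrite ET DT.
have trD (B C : 'M[R]_n.+1) : (B + C)^T = B^T + C^T by exact: linearD.
have trZ (a : R) (B : 'M[R]_n.+1) : (a *: B)^T = a *: B^T by exact: linearZ.
have YT : Y^T = Y.
  have e1 : @trmx R _ _ (E * D * A^T) = A * (E * D).
    by apply: etrans (trmx_mul _ _) _; congr (_ *m _); [exact: trmxK|].
  have e2 : @trmx R _ _ (A * (E * D)) = E * D * A^T.
    by apply: etrans (trmx_mul _ _) _; congr (_ *m _).
  by rewrite /Y !trD trZ EDT e1 e2 addrAC.
have YE : Y = S * (K - M * E) * S' * D.
  have -> : S * (K - M * E) * S' * D = S * K * S' * D - S * M * S' * (E * D).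
    by rewrite mulrBr !mulrBl !mulrA -[S * M * S' * E]mulrA S'E !mulrA.
  have -> : S * M * S' = (2 * x)%:M - A.
    rewrite ME mulrBr mulrBl -scalerAr -scalerAl -/A; congr (_ - _).
    by rewrite -[S * _%:M]/(S *m _%:M) mul_mx_scalar -scalerAl SS' scalemx1.
  rewrite /Y bal mulrBl -[_%:M * _]/(_%:M *m _) mul_scalar_mx.
  by rewrite scaleNr opprB -addrA addrC addrA.
have XL : S * (K + F * M) * S' * Ls * D = Ls * Y.
  rewrite YE /Ls !mulrA -[S * _ * S' * S]mulrA S'S mulr1.
  rewrite -[S * L * S' * S]mulrA S'S mulr1.
  by rewrite -[S * _ * L]mulrA -LG !mulrA.
have : @trmx R _ _ (Ls * Y) = D * Ls^T * (S * (K + F * M) * S')^T.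
  rewrite -XL; apply: etrans (trmx_mul _ _) _; rewrite DT -[RHS]mulrA.
  congr (_ *m _).
  exact: trmx_mul.
have -> : @trmx R _ _ (Ls * Y) = Y * Ls^T.
  by apply: etrans (trmx_mul _ _) _; rewrite YT.
by rewrite -!mulrA => ->.
Qed.

Definition Psi_tr (R : realType) (n : nat) (alpha : 'rV[R]_n.+1)
    (c d x : R) : 'M[R]_n.+1 :=
  diag_mx alpha * (d *: ladder_mx R n +
    (d *: Jmx R n - (d * n.+2%:R + c)%:M) * hermite_shift_mx n x)
    * invmx (diag_mx alpha).

Lemma Psi_closed_form (R : realType) (n : nat) (H : nat -> {poly R})
    (alpha delta delta' : 'rV[R]_n.+1) (c d : R)
    (hH : hermite_polynomials H)
    (alpha_neq0 : forall i : 'I_n.+1, alpha 0 i != 0)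
    (delta_gt0 : forall i : 'I_n.+1, 0 < delta 0 i)
    (c_gt0 : 0 < c) (d_gt0 : 0 < d)
    (delta'E : diag_mx delta' = (d *: Jmx R n + c%:M) *m diag_mx delta)
    (alphaE : forall i j : 'I_n.+1, j = i.+1 :> nat ->
       alpha 0 j ^+ 2 / alpha 0 i ^+ 2 =
         d * i.+1%:R * (n.+1%:R - i.+1%:R) / (2 * (d * i.+1%:R + c))
         * (delta 0 j / delta 0 i)) (x : R) :
  Psi H alpha delta delta' x = (Psi_tr alpha c d x)^T.
Proof.
rewrite /Psi derive1E.
rewrite (derive_val (is_derive := is_derive_Wmx delta' x hH alpha_neq0)).
rewrite delta'E.
have US : diag_mx alpha \in unitmx by exact: unitmx_diag.
have UL := Lmx_unit n x hH.
have ULa : Lalpha H alpha x \in unitmx.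
  by rewrite /Lalpha !unitmx_mul unitmx_inv US UL.
have UD : diag_mx delta \in unitmx by apply: unitmx_diag => i; rewrite gt_eqF.
have UW : Wmx H alpha delta x \in unitmx.
  rewrite /Wmx unitmxZ ?unitfE ?gt_eqF ?expR_gt0//.
  by rewrite unitmx_mul unitmx_tr ULa unitmx_mul ULa UD.
apply: (canLR (mulKmx UW)).
rewrite /Wmx -scalemxAl; congr (_ *: _).
have := shift_balance alpha_neq0 delta_gt0 c_gt0 d_gt0 alphaE.
have := Lmx_conjugation n x c d hH.
have : diag_mx delta * (d *: Jmx R n + c%:M) =
  (d *: Jmx R n + c%:M) * diag_mx delta.
  rewrite mulrDr mulrDl -scalerAr -scalerAl; congr (_ *: _ + _).
    exact: diag_mxC.
  exact: scalar_mxC.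
have : invmx (diag_mx alpha) * (d *: Jmx R n + c%:M) =
  (d *: Jmx R n + c%:M) * invmx (diag_mx alpha).
  rewrite mulrDr mulrDl -scalerAr -scalerAl invmx_diag//; congr (_ *: _ + _).
    exact: diag_mxC.
  exact: scalar_mxC.
have : invmx (diag_mx alpha) * diag_mx alpha = 1 by exact: mulVmx.
have : hermite_shift_mx n x = (2 * x)%:M - 2 *: shift_mx R n.
  by rewrite /hermite_shift_mx scalerBr scale_scalar_mx.
rewrite /Psi_tr /Lalpha !mulmxE.
have : (diag_mx delta)^T = diag_mx delta by exact: tr_diag_mx.
have : (d *: Jmx R n + c%:M)^T = d *: Jmx R n + c%:M.
  by rewrite linearD/= linearZ/= tr_diag_mx tr_scalar_mx.
move=> ET DT ME S'S S'E DE LG bal.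
exact: (intertwining_transport S'S (mulmxV US) S'E DE ET DT ME LG bal).
Qed.

Lemma size_affine (R : nzRingType) (A B : R) :
  A != 0 -> size (A%:P * 'X + B%:P) = 2.
Proof. by move=> A0; rewrite size_MXaddC polyC_eq0 (negPf A0)/= size_polyC A0. Qed.

Theorem proposition3p7 (R : realType) (n : nat) (H : nat -> {poly R})
    (alpha delta delta' : 'rV[R]_n.+1) (c d : R)
    (hH : hermite_polynomials H)
    (alpha_neq0 : forall i : 'I_n.+1, alpha 0 i != 0)
    (alpha1 : alpha 0 ord0 = 1)
    (delta_gt0 : forall i : 'I_n.+1, 0 < delta 0 i)
    (delta'_gt0 : forall i : 'I_n.+1, 0 < delta' 0 i)
    (c_gt0 : 0 < c) (d_gt0 : 0 < d)
    (delta'E : diag_mx delta' = (d *: Jmx R n + c%:M) *m diag_mx delta)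
    (alphaE : forall i j : 'I_n.+1, j = i.+1 :> nat ->
       alpha 0 j ^+ 2 / alpha 0 i ^+ 2 =
         d * i.+1%:R * (n.+1%:R - i.+1%:R) / (2 * (d * i.+1%:R + c))
         * (delta 0 j / delta 0 i)) :
  mx_polynomial_of_degree 1 (Psi H alpha delta delta').
Proof.
pose S := diag_mx alpha.
pose F : 'M[R]_n.+1 := d *: Jmx R n - (d * n.+2%:R + c)%:M.
pose C1 : 'M[R]_n.+1 := (S * (2 *: F) * invmx S)^T.
pose C0 : 'M[R]_n.+1 :=
  (S * (d *: ladder_mx R n - 2 *: (F * shift_mx R n)) * invmx S)^T.
exists (C1%:P * 'X + C0%:P); split=> [|x].
  apply: size_affine; rewrite /C1 trmx_eq0.
  have US : S \in unitmx by exact: unitmx_diag.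
  apply/eqP => /(congr1 (fun A => invmx S *m A *m S)).
  rewrite -!mulmxE mulmx0 mul0mx -!mulmxA mulVmx// mulmx1 mulKmx//.
  (* The first diagonal entry of d J - d (N + 1) - c is - d N - c < 0. *)
  move=> /matrixP/(_ ord0 ord0); rewrite !mxE/= mulr1n => /eqP.
  rewrite mulf_eq0 pnatr_eq0/= => /eqP.
  rewrite mulr1 -natr1 mulrDr.
  have : 0 < d * n.+1%:R by rewrite mulr_gt0// ltr0Sn.
  lra.
rewrite (Psi_closed_form hH alpha_neq0 delta_gt0 c_gt0 d_gt0 delta'E alphaE).
rewrite hornerMXaddC hornerC -[_ * x%:M]/(_ *m x%:M) mul_mx_scalar.
rewrite /C1 /C0; set B1 := S * _ * _; set B0 := S * _ * _.
have -> : Psi_tr alpha c d x = x *: B1 + B0; last exact: linearP.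
rewrite /Psi_tr -/S -/F /hermite_shift_mx /B1 /B0 scalerAl scalerAr -mulrDl -mulrDr.
congr (_ * _ * _); rewrite -!scalerAr mulrBr -[F * x%:M]/(F *m x%:M) mul_mx_scalar.
by rewrite scalerBr !scalerA [2 * x]mulrC addrCA.
Qed.
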